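(* An odd prime $p$ is G-regular if and only if it is B-regular and satisfies $\operatorname{ord}_p(4)=(p-1)/2$.
   Context: Bernoulli numbers $B_n$ are defined by $\frac{t}{e^t-1}=\sum_{n\ge0}B_n\frac{t^n}{n!}$. An odd prime $p$ is B-irregular if $p$ divides the numerator of at least one of $B_2,B_4,\ldots,B_{p-3}$, and B-regular otherwise. Genocchi numbers $G_n$ are defined by $\frac{2t}{e^t+1}=\sum_{n\ge 1}G_n\frac{t^n}{n!}$; an odd prime $p$ is G-irregular if it divides at least one of the integers $G_2,G_4,\ldots,G_{p-3}$, and G-regular otherwise. For an odd prime $p$ and integer $g$ with $p\nmid g$, $\operatorname{ord}_p(g)$ is the multiplicative order of $g$ modulo $p$. *)

(* Defs.v *)
From HB Require Import structures.
From mathcomp Require Import all_boot all_order all_algebra all_fingroup.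
From mathcomp Require Import cyclic.

Set Implicit Arguments.
Unset Strict Implicit.
Unset Printing Implicit Defensive.

Import Order.TTheory GRing.Theory Num.Theory.

Local Open Scope ring_scope.

(* Formal power series over the rationals, as coefficient sequences. *)
Definition fps := nat -> rat.

Definition fps_const (c : rat) : fps := fun n => if n is 0 then c else 0.
Definition fps_X : fps := fun n => (n == 1)%:R.
Definition fps_exp : fps := fun n => (n`!)%:R^-1.
Definition fps_add (f g : fps) : fps := fun n => f n + g n.
Definition fps_scale (c : rat) (f : fps) : fps := fun n => c * f n.
Definition fps_mul (f g : fps) : fps :=
  fun n => \sum_(i < n.+1) f i * g (n - i)%N.

(* f / t, for f without constant term. *)
Definition fps_divX (f : fps) : fps := fun n => f n.+1.

(* First n coefficients of f / g by long division, for g 0 != 0. *)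
Fixpoint fps_div_seq (f g : fps) (n : nat) : seq rat :=
  if n is m.+1 then
    let q := fps_div_seq f g m in
    rcons q ((f m - \sum_(i < m) q`_i * g (m - i)%N) / g 0)
  else [::].

Definition fps_div (f g : fps) : fps := fun n => (fps_div_seq f g n.+1)`_n.

(* The series \sum_n a_n t^n / n!. *)
Definition egf (a : nat -> rat) : fps := fun n => a n / (n`!)%:R.

Definition fps_expB1 : fps := fps_add fps_exp (fps_const (-1)).
Definition fps_expD1 : fps := fps_add fps_exp (fps_const 1).

(* In t / (e^t - 1), one factor t is cancelled before dividing; bernoulli_egf
   and bernoulli_unique below state the defining property. *)
Definition bernoulli (n : nat) : rat :=
  (n`!)%:R * fps_div (fps_divX fps_X) (fps_divX fps_expB1) n.

Definition genocchi (n : nat) : rat :=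
  (n`!)%:R * fps_div (fps_scale 2 fps_X) fps_expD1 n.

Lemma size_fps_div_seq f g n : size (fps_div_seq f g n) = n.
Proof. by elim: n => //= n IHn; rewrite size_rcons IHn. Qed.

Lemma nth_fps_div_seq f g n i :
  (i < n)%N -> (fps_div_seq f g n)`_i = fps_div f g i.
Proof.
elim: n => // n IHn; rewrite ltnS leq_eqVlt => /predU1P[-> //|lt_in].
by rewrite /= nth_rcons size_fps_div_seq lt_in IHn.
Qed.

Lemma fps_mul_div f g : g 0 != 0 -> fps_mul (fps_div f g) g =1 f.
Proof.
move=> g0 n; rewrite /fps_mul big_ord_recr /= subnn.
rewrite {2}/fps_div /= nth_rcons size_fps_div_seq ltnn eqxx divfK //.
rewrite [X in f n - X](eq_bigr (fun i : 'I_n => fps_div f g i * g (n - i)%N)).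
  by rewrite addrC subrK.
by move=> i _; rewrite nth_fps_div_seq.
Qed.

Lemma fps_mul_inj f1 f2 g :
  g 0 != 0 -> fps_mul f1 g =1 fps_mul f2 g -> f1 =1 f2.
Proof.
move=> g0 eq_fg n; elim/ltn_ind: n => n IHn; have := eq_fg n.
rewrite /fps_mul !big_ord_recr /= subnn.
under eq_bigr => i _ do rewrite IHn //.
by move=> /addrI /(mulIf g0).
Qed.

Lemma fps_mul_divX f g :
  g 0 = 0 -> fps_mul f g 0 = 0 /\ fps_divX (fps_mul f g) =1 fps_mul f (fps_divX g).
Proof.
move=> g0; split=> [|n]; first by rewrite /fps_mul big_ord_recl big_ord0 g0 mulr0 addr0.
rewrite /fps_divX /fps_mul big_ord_recr /= subnn g0 mulr0 addr0.
by apply: eq_bigr => i _; rewrite subSn // -ltnS.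
Qed.

Lemma egfK (c : fps) : egf (fun n => (n`!)%:R * c n) =1 c.
Proof.
by move=> n; rewrite /egf mulrC mulKf // pnatr_eq0 -lt0n fact_gt0.
Qed.

Lemma egf_inj a b : egf a =1 egf b -> a =1 b.
Proof.
move=> eq_ab n; have := eq_ab n; rewrite /egf; apply: mulIf.
by rewrite invr_eq0 pnatr_eq0 -lt0n fact_gt0.
Qed.

Lemma eq_fps_mull f1 f2 g : f1 =1 f2 -> fps_mul f1 g =1 fps_mul f2 g.
Proof. by move=> eq_f n; apply: eq_bigr => i _; rewrite eq_f. Qed.

Lemma bernoulli_egf : fps_mul (egf bernoulli) fps_expB1 =1 fps_X.
Proof.
have [E0 ES] := fps_mul_divX (egf bernoulli) (g := fps_expB1) (erefl _).
case=> [|n]; first exact: E0.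
rewrite -[LHS]/(fps_divX _ n) ES (eq_fps_mull _ (egfK _)).
by rewrite fps_mul_div.
Qed.

Lemma bernoulli_unique B :
  fps_mul (egf B) fps_expB1 =1 fps_X -> B =1 bernoulli.
Proof.
move=> defB; apply/egf_inj/(@fps_mul_inj _ _ (fps_divX fps_expB1)) => // n.
have [_ <-] := fps_mul_divX (egf B) (g := fps_expB1) (erefl _).
have [_ <-] := fps_mul_divX (egf bernoulli) (g := fps_expB1) (erefl _).
by rewrite /fps_divX defB bernoulli_egf.
Qed.

Lemma genocchi_egf : fps_mul (egf genocchi) fps_expD1 =1 fps_scale 2 fps_X.
Proof. by move=> n; rewrite (eq_fps_mull _ (egfK _)) fps_mul_div. Qed.

Lemma genocchi_unique G :
  fps_mul (egf G) fps_expD1 =1 fps_scale 2 fps_X -> G =1 genocchi.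
Proof.
move=> defG; apply/egf_inj/(@fps_mul_inj _ _ fps_expD1) => // n.
by rewrite defG genocchi_egf.
Qed.

Definition B_irregular (p : nat) : Prop :=
  exists k : nat,
    [/\ (2 <= k <= p - 3)%N, ~~ odd k & (p%:Z %| numq (bernoulli k))%Z].

Definition B_regular (p : nat) : Prop := ~ B_irregular p.

(* genocchi k is an integer in the type rat, and "p divides it" is written out
   as membership in p Z. *)
Definition G_irregular (p : nat) : Prop :=
  exists k : nat,
    [/\ (2 <= k <= p - 3)%N, ~~ odd k
      & exists m : int, genocchi k = (p%:Z * m)%:~R].

Definition G_regular (p : nat) : Prop := ~ G_irregular p.

(* Order of the class of g in the unit group of 'F_p; meant for p prime not
   dividing g (otherwise insubd returns the default 1). *)
Definition ord_mod (p : nat) (g : int) : nat :=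
  #[insubd (1%g : {unit 'F_p}) (g%:~R : 'F_p)]%g.

Lemma intr_Fp_eq0 p (z : int) : prime p -> (z%:~R == 0 :> 'F_p) = (p%:Z %| z)%Z.
Proof.
move=> p_pr; have chp := pchar_Fp p_pr.
by case: z => n; rewrite ?NegzE ?mulrNz ?oppr_eq0 ?dvdzN -pmulrn -(dvdn_pcharf chp) ?dvdzE.
Qed.
Lemma ord_mod_dvd p (g : int) n : prime p -> ~~ (p%:Z %| g)%Z ->
  (ord_mod p g %| n)%N = (g ^+ n == 1 %[mod p%:Z])%Z.
Proof.
move=> p_pr ndvd; rewrite /ord_mod order_dvdn -val_eqE FinRing.val_unitX.
rewrite FinRing.val_unit1 insubdK ?unfold_in ?unitfE ?intr_Fp_eq0 //.
  by rewrite -rmorphXn /= eqz_mod_dvd -(intr_Fp_eq0 _ p_pr) rmorphB /= rmorph1 subr_eq0.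
by rewrite -[X in is_true X]/(_ \is a GRing.unit) unitfE intr_Fp_eq0.
Qed.

(* Main.v *)
(** The identity 2t/(e^t+1) = 2t/(e^t-1) - 2(2t)/(e^(2t)-1) gives
    G_n = 2(1 - 2^n) B_n, so for even 2 <= k <= p-3 the prime p divides G_k
    exactly when it divides the numerator of B_k or 4^(k/2) - 1; the latter is
    excluded for all such k exactly when the order of 4, a divisor of (p-1)/2,
    is (p-1)/2 itself.

    Divisibility of G_k is meant in Z, so one also needs that G_k is an integer.
    This is checked prime by prime: away from 2 by the recurrence
    2 G_n = - sum_(i < n) C(n,i) G_i (n > 1), and at 2 from the integrality of
    2 B_n, which follows from
    B(t) (e^(2t) - 1)/t = e^t + 1 because 2^j/(j+1) is 2-integral. *)
Require Import Defs.
From mathcomp Require Import all_boot all_order all_algebra all_fingroup.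
From mathcomp Require Import cyclic zify ring.

Set Implicit Arguments.
Unset Strict Implicit.
Unset Printing Implicit Defensive.

Import Order.TTheory GRing.Theory Num.Theory.

Local Open Scope ring_scope.

(** * Ring laws for formal power series *)

Lemma natf_neq0 n : (n`!)%:R != 0 :> rat.
Proof. by rewrite pnatr_eq0 -lt0n fact_gt0. Qed.

Lemma natr_bin n i : (i <= n)%N ->
  'C(n, i)%:R = (n`!)%:R / ((i`!)%:R * ((n - i)`!)%:R) :> rat.
Proof.
move=> le_in; rewrite -(bin_fact le_in) !natrM mulfK //.
by rewrite mulf_neq0 ?natf_neq0.
Qed.

(** Coefficients below N see only truncations, so commutativity and associativity carry over from
    polynomials. *)
Lemma fps_mul_poly f g N n : (n < N)%N ->
  fps_mul f g n = ((\poly_(i < N) f i) * (\poly_(i < N) g i))`_n.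
Proof.
move=> lt_nN; rewrite coefM; apply: eq_bigr => i _.
by rewrite !coef_poly !ifT //; have := ltn_ord i; lia.
Qed.

Lemma fps_mulC f g : fps_mul f g =1 fps_mul g f.
Proof. by move=> n; rewrite !(fps_mul_poly _ _ (ltnSn n)) mulrC. Qed.

Lemma eq_fps_mulr f g1 g2 : g1 =1 g2 -> fps_mul f g1 =1 fps_mul f g2.
Proof. by move=> eq_g n; apply: eq_bigr => i _; rewrite eq_g. Qed.

Lemma fps_mulA f g h : fps_mul f (fps_mul g h) =1 fps_mul (fps_mul f g) h.
Proof.
move=> n; transitivity ((\poly_(i < n.+1) f i * (\poly_(i < n.+1) g i
    * \poly_(i < n.+1) h i))`_n).
  rewrite coefM; apply: eq_bigr => i _; have lt_i := ltn_ord i.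
  by rewrite coef_poly lt_i -fps_mul_poly // ltnS leq_subr.
rewrite mulrA coefM; apply: eq_bigr => i _.
by rewrite -fps_mul_poly // coef_poly ltnS leq_subr.
Qed.

Lemma fps_mulDl f g h n :
  fps_mul (fps_add f g) h n = fps_mul f h n + fps_mul g h n.
Proof.
by rewrite /fps_mul -big_split; apply: eq_bigr => i _; rewrite /fps_add mulrDl.
Qed.

Lemma fps_mul_scalel c f g n : fps_mul (fps_scale c f) g n = c * fps_mul f g n.
Proof. by rewrite /fps_mul mulr_sumr; apply: eq_bigr => i _; rewrite mulrA. Qed.

Lemma fps_mul_constl c f n : fps_mul (fps_const c) f n = c * f n.
Proof.
rewrite /fps_mul big_ord_recl subn0 big1 ?addr0 // => i _.
by rewrite mul0r.
Qed.

Lemma fps_mulXl f n : fps_mul fps_X f n.+1 = f n.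
Proof.
rewrite /fps_mul 2!big_ord_recl big1 ?addr0 /fps_X ?mul0r ?add0r ?mul1r.
  by rewrite subn1.
by move=> i _; rewrite mul0r.
Qed.

(** Since e^t - 1 has zero constant term, a factor t is cancelled first; the quotient has constant
    term 1. *)
Lemma fps_mul_expB1_inj f g :
  fps_mul f fps_expB1 =1 fps_mul g fps_expB1 -> f =1 g.
Proof.
move=> eq_fg; apply: (@fps_mul_inj _ _ (fps_divX fps_expB1)) => // n.
have [_ <-] := fps_mul_divX f (g := fps_expB1) (erefl _).
have [_ <-] := fps_mul_divX g (g := fps_expB1) (erefl _).
exact: eq_fg.
Qed.

(** * The relation between Genocchi and Bernoulli numbers *)

(** The substitution t -> ct. *)
Definition fps_dil (c : rat) (f : fps) : fps := fun n => c ^+ n * f n.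

Lemma fps_mul_dil c f g :
  fps_mul (fps_dil c f) (fps_dil c g) =1 fps_dil c (fps_mul f g).
Proof.
move=> n; rewrite /fps_mul /fps_dil mulr_sumr; apply: eq_bigr => i _.
by rewrite mulrACA -exprD subnKC // -ltnS.
Qed.

(** The binomial expansion of (1 + 1)^n, divided by n!. *)
Lemma fps_mul_exp : fps_mul fps_exp fps_exp =1 fps_dil 2 fps_exp.
Proof.
move=> n; rewrite /fps_dil -[2]/(1 + 1) exprDn mulr_suml; apply: eq_bigr => i _.
rewrite !expr1n mulr1 natr_bin; last by rewrite -ltnS.
by rewrite /fps_exp mulrAC divff ?natf_neq0 // invfM mul1r.
Qed.

Lemma fps_mul_expB1_expD1 : fps_mul fps_expB1 fps_expD1 =1 fps_dil 2 fps_expB1.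
Proof.
move=> n; rewrite fps_mulDl fps_mul_constl fps_mulC fps_mulDl fps_mul_constl.
rewrite fps_mul_exp /fps_expD1 /fps_expB1 /fps_dil /fps_add mulrDr.
rewrite [X in _ + X = _](_ : _ = - fps_exp n - fps_const 1 n); last by ring.
by case: n => [|n] /=; ring.
Qed.

Lemma genocchi_bernoulli n : genocchi n = 2 * (1 - 2 ^+ n) * bernoulli n.
Proof.
rewrite -(@genocchi_unique (fun n => 2 * (1 - 2 ^+ n) * bernoulli n)) //.
(* After multiplication by e^t - 1, the left side is (2B(t) - 2B(2t))(e^(2t) - 1) = 2t(e^t + 1) - 4t
   = 2t(e^t - 1). *)
apply: fps_mul_expB1_inj => {}n; rewrite -fps_mulA.
rewrite (eq_fps_mulr _ (fps_mulC _ _)) (eq_fps_mulr _ fps_mul_expB1_expD1).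
have defG : egf (fun n => 2 * (1 - 2 ^+ n) * bernoulli n) =1
    fps_add (fps_scale 2 (egf bernoulli))
            (fps_scale (-2) (fps_dil 2 (egf bernoulli))).
  by move=> m; rewrite /egf /fps_add /fps_scale /fps_dil; ring.
rewrite (eq_fps_mull _ defG) fps_mulDl !fps_mul_scalel fps_mul_dil.
rewrite -(eq_fps_mulr _ fps_mul_expB1_expD1) fps_mulA.
rewrite (eq_fps_mull _ bernoulli_egf) fps_mulC fps_mulDl fps_mul_constl.
rewrite /fps_dil bernoulli_egf -(fps_mulC fps_X).
rewrite -(fps_mulC fps_expB1) fps_mulDl fps_mul_constl -(fps_mulC fps_X).
by rewrite /fps_X; case: eqP => [->|_] /=; ring.
Qed.

(** * Rational numbers integral at q *)

(** For prime q this is the localization of Z at q. Any denominator prime to q is accepted, reduced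
    or not, so sums and products just multiply denominators. *)
Definition local_int (q : nat) (x : rat) : Prop :=
  exists2 d : nat, coprime q d & x * d%:R \is a Num.int.

Lemma local_int_int q x : x \is a Num.int -> local_int q x.
Proof. by move=> xZ; exists 1%N; rewrite ?coprimen1 ?mulr1 //. Qed.

Lemma local_intD q x y : local_int q x -> local_int q y -> local_int q (x + y).
Proof.
move=> [d cd xZ] [e ce yZ]; exists (d * e)%N; first by rewrite coprimeMr cd.
rewrite natrM (_ : _ * _ = x * d%:R * e%:R + y * e%:R * d%:R); last by ring.
by apply: rpredD; apply: rpredM; rewrite ?rpred_nat.
Qed.

Lemma local_intM q x y : local_int q x -> local_int q y -> local_int q (x * y).
Proof.
move=> [d cd xZ] [e ce yZ]; exists (d * e)%N; first by rewrite coprimeMr cd.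
by rewrite natrM mulrACA rpredM.
Qed.

Lemma local_intN q x : local_int q x -> local_int q (- x).
Proof. by move=> [d cd xZ]; exists d; rewrite // mulNr rpredN. Qed.

Lemma local_int_sum q (I : finType) (F : I -> rat) :
  (forall i, local_int q (F i)) -> local_int q (\sum_i F i).
Proof.
by move=> FZ; apply: big_ind => //; [apply: local_int_int | apply: local_intD].
Qed.

Lemma local_int_invn q d : (0 < d)%N -> coprime q d -> local_int q d%:R^-1.
Proof. by move=> d0 cd; exists d; rewrite // mulVf // pnatr_eq0 -lt0n. Qed.

(** By Gauss, the reduced denominator divides every d for which xd is an integer. *)
Lemma local_int_denq q x : local_int q x -> coprime q `|denq x|.
Proof.
move=> [d cd /intrP[a Ea]]; apply: coprime_dvdr cd.
have: numq x * d%:Z = a * denq x.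
  apply: (@intr_inj rat); rewrite !rmorphM /= -Ea numqE -pmulrn; ring.
move=> E; rewrite -(@Gauss_dvdr _ `|numq x|); last first.
  by rewrite coprime_sym coprime_num_den.
by rewrite -[d]/(`|d%:Z|%N) -abszM E abszM dvdn_mull.
Qed.

Lemma local_int_all x :
  (forall q, prime q -> local_int q x) -> exists m : int, x = m%:~R.
Proof.
move=> xZ; exists (numq x); rewrite numqE -[LHS]mulr1; congr (_ * _).
have: `|denq x|%N = 1%N.
  apply/eqP/contraT=> den1; set d := `|denq x|%N in den1.
  have pr_q: prime (pdiv d).
    by apply: pdiv_prime; have := denq_gt0 x; rewrite /d in den1 *; lia.
  have := local_int_denq (xZ _ pr_q).
  by rewrite prime_coprime // pdiv_dvd.
by have := denq_gt0 x => ? ?; have -> : denq x = 1 by lia.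
Qed.

(** * Integrality of Bernoulli and Genocchi numbers *)

Lemma mulfact_egf a n : (n`!)%:R * egf a n = a n.
Proof. by rewrite mulrC divfK ?natf_neq0. Qed.

Lemma mulfact_egf_mul a b n :
  (n`!)%:R * fps_mul (egf a) (egf b) n
  = \sum_(i < n.+1) 'C(n, i)%:R * a i * b (n - i)%N.
Proof.
rewrite mulr_sumr; apply: eq_bigr => i _; rewrite natr_bin -1?ltnS // /egf.
by field; rewrite !natf_neq0.
Qed.

(** The recurrence from B(t) (e^t - 1)/t = 1 has as denominators only factorials up to (n+1)!, all
    prime to p. *)
Lemma bernoulli_local_int p n :
  prime p -> (n.+1 < p)%N -> local_int p (bernoulli n).
Proof.
move=> pr_p lt_np.
have coprime_fact m : (m < p)%N -> coprime p m`!.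
  elim: m => [|m IHm] lt_mp; first by rewrite coprimen1.
  rewrite factS coprimeMr IHm ?(ltnW lt_mp) // andbT prime_coprime //.
  by rewrite gtnNdvd.
suff bn : local_int p (egf bernoulli n).
  rewrite -mulfact_egf.
  by apply: local_intM => //; apply: local_int_int; rewrite rpred_nat.
elim/ltn_ind: n lt_np => n IHn lt_np.
have /(_ n) := (fps_mul_divX (egf bernoulli) (g := fps_expB1) (erefl _)).2.
rewrite /fps_divX bernoulli_egf /fps_mul big_ord_recr /= subnn.
rewrite {2}/fps_expB1 /fps_add /fps_exp /= addr0 invr1 mulr1 => /eqP.
rewrite addrC -subr_eq => /eqP <-.
apply: local_intD; first by apply: local_int_int; rewrite /fps_X rpred_nat.
apply/local_intN/local_int_sum => i; have lt_in := ltn_ord i.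
apply: local_intM; first by apply: IHn => //; lia.
rewrite /fps_expB1 /fps_add /= addr0; apply: local_int_invn; rewrite ?fact_gt0 //.
by apply: coprime_fact; lia.
Qed.

(** If 2^v is the exact power of 2 in j+1, then 2^v <= j+1 < 2^(j+1), so v <= j. *)
Lemma local_int2_exp2_div j : local_int 2 (2 ^+ j / j.+1%:R).
Proof.
have [m odd_m Ej] := pfactor_coprime (isT : prime 2) (isT : (0 < j.+1)%N).
set v := logn 2 j.+1 in Ej.
have m0 : (0 < m)%N by case: m odd_m Ej.
have le_vj : (v <= j)%N.
  rewrite -ltnS -(ltn_exp2l _ _ (isT : (1 < 2)%N)).
  apply: (@leq_ltn_trans j.+1); last by rewrite ltn_expl.
  by rewrite Ej leq_pmull.
rewrite Ej natrM natrX -{1}(subnK le_vj) exprD invfM mulrCA mulrC.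
rewrite mulfK ?expf_neq0 //.
apply: local_intM; last exact: local_int_invn.
by apply: local_int_int; rewrite rpredX ?rpred_nat.
Qed.

Lemma bernoulli_local_int2 n : local_int 2 (2 * bernoulli n).
Proof.
elim/ltn_ind: n => n IHn.
have E : \sum_(i < n.+1) egf bernoulli i * (2 ^+ (n - i).+1 / (n - i).+1`!%:R)
    = fps_expD1 n.
  transitivity (fps_divX (fps_mul (egf bernoulli) (fps_dil 2 fps_expB1)) n).
    rewrite (fps_mul_divX _ _).2; last by rewrite /fps_dil mulr0.
    apply: eq_bigr => i _; congr (_ * _).
    by rewrite /fps_divX /fps_dil /fps_expB1 /fps_add /= addr0.
  rewrite /fps_divX -(eq_fps_mulr _ fps_mul_expB1_expD1) fps_mulA.
  by rewrite (eq_fps_mull _ bernoulli_egf) fps_mulXl.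
(* Multiplying by n! turns the factorials into binomials; the term i = n is then 2 B_n itself. *)
have {}E : \sum_(i < n.+1) 'C(n, i)%:R * (2 * bernoulli i)
      * (2 ^+ (n - i) / (n - i).+1%:R) = (n`!)%:R * fps_expD1 n.
  rewrite -E mulr_sumr; apply: eq_bigr => i _; rewrite natr_bin -1?ltnS // /egf.
  rewrite factS natrM exprS; field.
  by rewrite !natf_neq0 addrC natr1 pnatr_eq0.
move: E; rewrite big_ord_recr /= subnn binn expr0 !divr1 mul1r => /eqP.
rewrite addrC eq_sym -subr_eq => /eqP <-; apply: local_intD.
  apply: local_int_int; rewrite /fps_expD1 /fps_add /fps_exp mulrDr.
  rewrite divff ?natf_neq0 // rpredD ?rpredM ?rpred_nat //.
  by case: n {IHn}.
apply/local_intN/local_int_sum => i; apply: local_intM; last first.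
  exact: local_int2_exp2_div.
apply: local_intM; last exact: IHn.
by apply: local_int_int; rewrite rpred_nat.
Qed.

Lemma genocchi_local_int_odd q n : odd q -> local_int q (genocchi n).
Proof.
move=> odd_q; elim/ltn_ind: n => n IHn.
(* The coefficient of t^n in G(t) e^t + G(t) = 2t, with e^t written as the [egf] of the constant
   1. *)
have E : fps_mul (egf genocchi) (egf (fun=> 1)) n + egf genocchi n = 2 * fps_X n.
  rewrite -[2 * _](genocchi_egf n) -(fps_mulC fps_expD1) fps_mulDl.
  rewrite fps_mul_constl mul1r fps_mulC; congr (_ + _).
  by apply: eq_fps_mull => m; rewrite /egf mul1r.
have {}E : \sum_(i < n) 'C(n, i)%:R * genocchi i + 2 * genocchi n
      = (n`!)%:R * (2 * fps_X n).
  rewrite -E mulrDr mulfact_egf_mul big_ord_recr /= binn mul1r mulr1.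
  rewrite -addrA mulfact_egf; congr (_ + _); last by ring.
  by apply: eq_bigr => i _; rewrite mulr1.
(* Solving the recurrence for G_n divides by 2, which is prime to the odd q. *)
rewrite -[genocchi n](mulKf (isT : 2 != 0 :> rat)); apply: local_intM.
  by apply: local_int_invn; rewrite // coprimen2.
move/eqP: E; rewrite addrC eq_sym -subr_eq => /eqP <-; apply: local_intD.
  by apply: local_int_int; rewrite !rpredM ?rpred_nat.
apply/local_intN/local_int_sum => i; apply: local_intM; last exact: IHn.
by apply: local_int_int; rewrite rpred_nat.
Qed.

Lemma genocchi_int n : exists m : int, genocchi n = m%:~R.
Proof.
apply: local_int_all => q pr_q; case: (even_prime pr_q) => [->|].
  rewrite genocchi_bernoulli mulrAC; apply: local_intM.
    exact: bernoulli_local_int2.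
  by apply: local_int_int; rewrite rpredB ?rpredX ?rpred_nat.
exact: genocchi_local_int_odd.
Qed.

(** * Divisibility of Genocchi numbers and the order of 4 *)

Lemma Euclid_dvdzM p (a b : int) :
  prime p -> (p%:Z %| a * b)%Z = (p%:Z %| a)%Z || (p%:Z %| b)%Z.
Proof. by move=> pr_p; rewrite !dvdzE abszM Euclid_dvdM. Qed.

Lemma numq_genocchi k (m : int) : genocchi k = m%:~R ->
  m * denq (bernoulli k) = 2 * (1 - 2 ^+ k) * numq (bernoulli k).
Proof.
move=> Em; apply: (@intr_inj rat).
by rewrite !rmorphM rmorphB rmorphXn /= -Em genocchi_bernoulli numqE [RHS]mulrA.
Qed.

(** In the integer form of G_k = 2(1 - 2^k) B_k, the prime p divides neither 2 nor, as k+1 < p, the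
    denominator of B_k; Euclid's lemma does the rest. *)
Lemma dvd_genocchi p k : prime p -> odd p -> (k.+1 < p)%N ->
  (exists m : int, genocchi k = (p%:Z * m)%:~R) <->
  (p%:Z %| numq (bernoulli k))%Z \/ (p%:Z %| 2 ^+ k - 1)%Z.
Proof.
move=> pr_p odd_p lt_kp.
have ndvd2 : ~~ (p%:Z %| 2)%Z.
  by rewrite dvdzE /= gtnNdvd // odd_prime_gt2.
have [m Em] := genocchi_int k; have E := numq_genocchi Em.
have Edvd : (p%:Z %| m)%Z || (p%:Z %| denq (bernoulli k))%Z =
    (p%:Z %| 2 ^+ k - 1)%Z || (p%:Z %| numq (bernoulli k))%Z.
  rewrite -Euclid_dvdzM // E !Euclid_dvdzM // (negPf ndvd2) /=.
  by rewrite -[1 - _]opprB !dvdzE abszN.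
have ndvd_den : ~~ (p%:Z %| denq (bernoulli k))%Z.
  rewrite dvdzE -prime_coprime //.
  by apply: local_int_denq; apply: bernoulli_local_int.
rewrite (negPf ndvd_den) orbF in Edvd; split.
  case=> m' Em'; apply/orP; rewrite orbC -Edvd.
  by have -> : m = p%:Z * m' by [apply: (@intr_inj rat); rewrite -Em];
    exact: dvdz_mulr.
by move/orP; rewrite orbC -Edvd => /dvdzP[m' Em']; exists m'; rewrite mulrC -Em'.
Qed.

Lemma ord_mod4_dvd p n : prime p -> odd p ->
  (ord_mod p 4 %| n)%N = (p%:Z %| 2 ^+ n.*2 - 1)%Z.
Proof.
move=> pr_p odd_p; rewrite ord_mod_dvd //; last first.
  rewrite -[4]/(2 * 2 : int) Euclid_dvdzM // orbb.
  by rewrite dvdzE /= gtnNdvd // odd_prime_gt2.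
by rewrite eqz_mod_dvd -[4]/(2 ^+ 2 : int) -exprM mul2n.
Qed.

Lemma ord_mod4_dvd_half p : prime p -> odd p -> (ord_mod p 4 %| (p - 1) %/ 2)%N.
Proof.
move=> pr_p odd_p; rewrite ord_mod4_dvd //.
have -> : ((p - 1) %/ 2).*2 = p.-1 by have := prime_gt0 pr_p; lia.
have cp2 : coprime 2 p by rewrite coprime2n.
(* Fermat: 4^((p-1)/2) = 2^(p-1) is 1 modulo p. *)
have := Euler_exp_totient cp2; rewrite totient_prime // => fermat.
by rewrite -eqz_mod_dvd -natrX natz !modz_nat fermat.
Qed.

Theorem theorem1p8 (p : nat) (p_prime : prime p) (p_odd : odd p) :
  G_regular p <-> B_regular p /\ ord_mod p 4 = ((p - 1) %/ 2)%N.
Proof.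
have ord_dvd := ord_mod4_dvd_half p_prime p_odd.
have p_gt2 := odd_prime_gt2 p_odd p_prime.
split=> [Greg | [Breg ord_half] [k [k_range k_even Gk]]].
  split=> [[k [k_range k_even Bk]] | ].
    by apply: Greg; exists k; split=> //; apply/dvd_genocchi => //; [lia | left].
  (* An order d other than (p-1)/2 is smaller, so k = 2d is at most p-3, and p divides 4^d - 1 = 2^k
     - 1. *)
  apply/eqP/contraT => ord_neq; case: Greg; exists (ord_mod p 4).*2.
  have ord_gt0 : (0 < ord_mod p 4)%N by rewrite order_gt0.
  have ord_le : (ord_mod p 4 <= (p - 1) %/ 2)%N by apply: dvdn_leq => //; lia.
  split; [lia | by rewrite odd_double | ].
  by apply/dvd_genocchi => //; [lia | right; rewrite -ord_mod4_dvd].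
have lt_kp : (k.+1 < p)%N by lia.
have [Bk | ] := (dvd_genocchi p_prime p_odd lt_kp).1 Gk.
  by apply: Breg; exists k.
(* Otherwise (p-1)/2 would divide k/2, which lies strictly between 0 and (p-1)/2. *)
have -> : k = k./2.*2 by lia.
rewrite -ord_mod4_dvd // ord_half => /dvdn_leq; lia.
Qed.
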